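(* Let $\langle\mathcal N,\varepsilon\rangle$ be the space of irrational numbers with the Euclidean topology. There are a set $X\subset\mathcal N$ of size $2^{\omega}$ and a 0-dimensional first countable topology $\tau$ on $X$ refining the subspace topology inherited from $\varepsilon$ such that (i) $X=Y\cup Z$ for some $Y,Z$ such that $\tau_Y=\varepsilon_Y$ and $\tau_Z=\varepsilon_Z$ (the subspace topologies on $Y$ inherited from $\tau$ and $\varepsilon$ coincide, and likewise on $Z$); (ii) $\langle X,\tau\rangle$ has an irreducible base. Thus $\chi(X)=nw(X)=\omega$ but $w(X)=2^{\omega}$ for the space $X=\langle X,\tau\rangle$.
   Context: $\chi$, $nw$, $w$ denote character, net weight and weight. A base $\mathcal U$ (of open sets) of a space $X$ is irreducible if it has an irreducible decomposition $\mathcal U=\bigcup\{\mathcal U_x:x\in X\}$, i.e. (1) $\mathcal U_x$ is a neighbourhood base of $x$ in $X$ for each $x\in X$; and (2) for each $x\in X$ the family $\bigcup_{y\ne x}\mathcal U_y$ is not a base of $X$ (hence it does not contain a neighbourhood base of $x$). *)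

(* Defs.v *)
From HB Require Import structures.
From mathcomp Require Import all_boot all_order all_algebra.
From mathcomp Require Import all_classical all_reals all_analysis.
Import numFieldNormedType.Exports.

Set Implicit Arguments.
Unset Strict Implicit.
Unset Printing Implicit Defensive.

Local Open Scope classical_set_scope.
Local Open Scope card_scope.

(* The initial topology that the library puts on the type of elements of a set
   is the subspace topology inherited from R. *)
Definition irrational_space (R : realType) : topologicalType :=
  set_type (@irrational R).

(* A topology on the bare type T. The class also records choice and decidable
   equality on T, which exist on every type classically and carry no
   topological information. *)
Notation topology_on T := (Topological.axioms_ T).

Section Spaces.
Variable T : topologicalType.
Implicit Types (x : T) (Y : set T) (B : set (set T)).

Definition subspace_opens Y : set (set T) := [set U `&` Y | U in @open T].

Definition nbhs_base x B :=
  B `<=` nbhs x /\ forall V, nbhs x V -> exists2 U, B U & U `<=` V.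

Definition first_countable :=
  forall x, exists2 B : set (set T), countable B & nbhs_base x B.

(* 0-dimensionality. The library's zero_dimensional only says that distinct
   points are separated by a clopen set, which does not give a clopen base. *)
Definition has_clopen_base := exists2 B : set (set T), basis B & B `<=` clopen.

Definition irreducible_decomposition B (Bx : T -> set (set T)) :=
  [/\ B = \bigcup_x Bx x,
      forall x, nbhs_base x (Bx x) &
      forall x, ~ basis (\bigcup_(y in [set~ x]) Bx y)].

Definition irreducible_base B :=
  basis B /\ exists Bx, irreducible_decomposition B Bx.

Definition network B :=
  forall V x, open V -> V x -> exists U, [/\ B U, U x & U `<=` V].

End Spaces.

Arguments first_countable : clear implicits.
Arguments has_clopen_base : clear implicits.

(* A cardinal is represented by any set D having that cardinality: the next
   predicates read "the invariant equals |D|". *)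

Definition least_card (V K : Type) (F : set (set V)) (D : set K) :=
  (exists2 B, F B & B #= D) /\ forall B, F B -> D #<= B.

Definition weight_is (T : topologicalType) (K : Type) (D : set K) :=
  least_card (@basis T) D.

Definition net_weight_is (T : topologicalType) (K : Type) (D : set K) :=
  least_card (@network T) D.

Definition point_character_is (T : topologicalType) (x : T)
    (K : Type) (D : set K) :=
  least_card (nbhs_base x) D.

(* The supremum over x of the characters at x. A neighbourhood base of x of
   least size is itself a set representing the character at x, so E need only
   range over families of subsets of T. *)
Definition character_is (T : topologicalType) (K : Type) (D : set K) :=
  (forall (x : T) (E : set (set T)), point_character_is x E -> E #<= D) /\
  forall (K' : Type) (D' : set K'),
    (forall (x : T) (E : set (set T)), point_character_is x E -> E #<= D') ->
    D #<= D'.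

(* Main.v *)
(** Let [X] be a zero-dimensional second countable T1 space whose set [Z] of
    isolated points is dense, and put [Y = X \ Z].  For each [y] in [Y] choose
    a sequence [S y] in [Z] converging to [y], and declare [V y = X \ S y] to
    be open.  No point of [Y] other than [y] is an accumulation point of
    [S y], so this only refines the neighbourhoods of [y], and only by points
    of [Z]; hence the topologies of [Y] and of [Z] do not change.  The clopen
    sets [D \ S y], with [D] basic and [y] in [D], form a neighbourhood base
    of [y] that is useless at every other [x] in [Y]: if [x] is in [D \ S y],
    then [D] contains almost all of [S x] and [S y] does not accumulate at
    [x], so [D \ S y] is not contained in [V x].  This yields an irreducible
    base, and it makes the weight at least the cardinality of [X].

    Such an [X] of size continuum is found among the decimals with digits at
    most 4: [Y] consists of irrational decimals with digits at most 3, and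
    the points of [Z] have a single digit 4, followed by a fixed tail. *)

From HB Require Import structures.
Require Import Defs.
From mathcomp Require Import all_boot all_order all_algebra.
From mathcomp Require Import all_classical all_reals all_analysis.
From mathcomp Require Import lra.
Import Order.TTheory GRing.Theory Num.Theory.
Import numFieldNormedType.Exports.

Set Implicit Arguments.
Unset Strict Implicit.
Unset Printing Implicit Defensive.

Local Open Scope classical_set_scope.
Local Open Scope card_scope.

(** * Cardinals and networks *)

Lemma injective_card_le (T U : Type) (f : T -> U) (B : set U) :
  injective f -> (forall x, B (f x)) -> [set: T] #<= B.
Proof.
move=> finj Bf; apply: (@card_le_trans _ _ _ (range f)); last first.
  by apply: subset_card_le => _ [x _ <-].
have := @inj_card_eq _ _ setT f (in2W finj).
by rewrite card_eq_le => /andP[].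
Qed.

Lemma card_leT_injective (T U : Type) :
  [set: T] #<= [set: U] -> exists f : T -> U, injective f.
Proof.
move=> /card_leP[f].
exists (fun x => \val (f (SigSub (mem_set I : x \in [set: T])))) => x y.
by move=> /val_inj/(@inj _ _ _ f _ _ (in_setT _) (in_setT _))/(congr1 \val).
Qed.

Lemma uncountable_cantor : ~ countable [set: nat -> bool].
Proof.
move=> /countable_injP[f finj].
pose b n := ~~ `[< exists2 a, f a = n & a n >].
have : b (f b) = ~~ b (f b).
  rewrite {1}/b; congr (~~ _); apply/asboolP/idP => [[a fab]|bb].
    by rewrite (finj a b) ?inE.
  by exists b.
by case: (b _).
Qed.

(* The continuum has uncountable cofinality: as [2^w = (2^w)^w], some fibre of
   the second component projects onto one of the [w] factors. *)
Lemma cantor_card_le_prod_nat (V : Type) (B : set V)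
    (f : (nat -> bool) -> V) (g : (nat -> bool) -> nat) :
  (forall b, B (f b)) -> (forall a b, f a = f b -> g a = g b -> a = b) ->
  [set: nat -> bool] #<= B.
Proof.
move=> Bf fg_inj.
pose coord (n : nat) (b : nat -> bool) (k : nat) := b (choice.pickle (n, k)).
have [n /choice[h hP]] : exists n, forall r, exists b, coord n b = r /\ g b = n.
  apply: contrapT => /forallNP nex.
  have /choice[r rP] : forall n, exists r, forall b, coord n b = r -> g b <> n.
    move=> n; have /existsNP[r /forallNP rP] := nex n.
    by exists r => b br gb; apply: (rP b).
  (* [b] glues the sequences [r n] together, [r n] being its [n]-th coordinate; the index [n = g b]
     then contradicts the choice of [r]. *)
  pose b m := if @choice.unpickle (nat * nat)%type m is Some nk
    then r nk.1 nk.2 else false.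
  apply: (rP (g b) b) => //; apply/funext => k.
  by rewrite /coord /b pickleK.
have fh_inj : injective (f \o h).
  move=> r s /= frs; have [hr gr] := hP r; have [hs gs] := hP s.
  by rewrite -hr -hs (fg_inj (h r) (h s)) ?gr ?gs.
by apply: injective_card_le fh_inj _ => r; exact: Bf.
Qed.

Section CountableNetworks.
Variable T : topologicalType.
Implicit Type B : set (set T).

(** An open set is the union of the network members inside it, so the set of their codes determines
    it. *)
Lemma network_card_open B :
  countable B -> network B -> @open T #<= [set: nat -> bool].
Proof.
move=> /countable_injP[f finj] nB; apply/pcard_injP.
exists (fun U n => `[< exists N, [/\ B N, N `<=` U & f N = n] >]).
suff sub U V : open U ->
    (fun n => `[< exists N, [/\ B N, N `<=` U & f N = n] >]) =
    (fun n => `[< exists N, [/\ B N, N `<=` V & f N = n] >]) -> U `<=` V.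
  by move=> U V /set_mem oU /set_mem oV e; apply/seteqP; split; exact: sub.
move=> oU e x Ux; have [N [BN Nx NU]] := nB _ _ oU Ux.
have eN := congr1 (fun F => F (f N)) e.
have : exists N', [/\ B N', N' `<=` U & f N' = f N] by exists N.
move=> /asboolP; rewrite [`[< _ >]]eN => /asboolP.
move=> [N' [BN' NV /finj]].
by rewrite !inE => NN'; apply: NV; rewrite NN'.
Qed.

Lemma network_card_points B : accessible_space T ->
  countable B -> network B -> [set: T] #<= [set: nat -> bool].
Proof.
move=> T1 cB nB; apply: card_le_trans (network_card_open cB nB).
apply: (@injective_card_le _ _ (fun x => ~` [set x])) => [x y|x].
  by move=> /setC_inj /seteqP[+ _]; apply.
exact/closed_openC/accessible_closed_set1.
Qed.

(** Choosing a point in each member of a finite network ([x0] for an empty one) gives a finite,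
    hence closed, set; yet a member lying in its complement contains its own chosen point. *)
Lemma network_infinite B :
  accessible_space T -> infinite_set [set: T] -> network B -> infinite_set B.
Proof.
move=> T1 infT nB finB; apply: infT.
have [[x0]|/forallNP no] := pselect (exists x : T, True); last first.
  by rewrite (_ : setT = set0)// -subset0 => x _; apply: (no x).
pose P := (fun N => xget x0 N) @` B.
have finP : finite_set P by exact: finite_image.
rewrite (_ : setT = P)//; apply/seteqP; split => // x _; apply: contrapT => Px.
have clP := iffLR accessible_finite_set_closed T1 _ finP.
have [N [BN Nx NP]] := nB (~` P) x (closed_openC clP) Px.
by apply: (NP (xget x0 N)); [apply: xgetPex; exists x | exists N].
Qed.

(** Here the chosen points must differ from [x]; each basic neighbourhood has one because [x] is not
    isolated. *)
Lemma nbhs_base_infinite B (x : T) :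
  accessible_space T -> ~ open [set x] -> nbhs_base x B -> infinite_set B.
Proof.
move=> T1 nox [Bx xB] finB.
pose P := (fun N => xget x (N `\ x)) @` B `\ x.
have clP : closed P.
  apply: (iffLR accessible_finite_set_closed T1).
  by apply: finite_setD; exact: finite_image.
have /xB[N BN NP] : nbhs x (~` P).
  by apply: open_nbhs_nbhs; split; [exact: closed_openC | by case=> _; apply].
have [[y [Ny yx]]|/forallNP no] := pselect ((N `\ x) !=set0); last first.
  apply: nox; rewrite openE => _ ->; apply: filterS (Bx _ BN) => z Nz.
  by apply: contrapT => zx; apply: (no z).
have [NN NNx] : (N `\ x) (xget x (N `\ x)) by apply: xgetPex; exists y.
by apply: (NP _ NN); split => //; exists N.
Qed.

(** A network of a discrete space contains every singleton. *)
Lemma countable_network_nonisolated B :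
  countable B -> network B -> ~ countable [set: T] ->
  exists x : T, ~ open [set x].
Proof.
move=> cB nB; apply: contra_notP => /forallNP iso; apply: sub_countable cB.
apply: (@injective_card_le _ _ set1) => [x y /seteqP[+ _]|x].
  by apply.
have [N [BN Nx Nx1]] := nB [set x] x (contrapT (iso x)) erefl.
by rewrite (_ : [set x] = N)//; apply/seteqP; split => // _ ->.
Qed.

Lemma net_weight_countable B :
  accessible_space T -> infinite_set [set: T] -> countable B -> network B ->
  net_weight_is T [set: nat].
Proof.
move=> T1 infT cB nB; split.
  by exists B => //; apply: eq_card_nat => //; exact: network_infinite.
by move=> C nC; apply/infiniteP; exact: network_infinite nC.
Qed.

Lemma character_countable (x : T) :
  accessible_space T -> ~ open [set x] -> first_countable T ->
  character_is T [set: nat].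
Proof.
move=> T1 nox fcT; split=> [y E [_ Emin]|K D Dmax].
  by have [B cB /Emin EB] := fcT y; exact: card_le_trans EB cB.
have [B cB xB] := fcT x; have infB := nbhs_base_infinite T1 nox xB.
apply: (@card_le_trans _ _ _ B); first exact/infiniteP.
(* [B] represents the character at [x]: it is countable, and every neighbourhood base at [x] is
   infinite. *)
apply: (Dmax x); split; first by exists B.
move=> C xC; apply: (card_le_trans cB); apply/infiniteP.
exact: nbhs_base_infinite xC.
Qed.

End CountableNetworks.

(** * Thinning the neighbourhoods of a space *)

(** By the second condition [removed x] accumulates at no point outside it except possibly [x], so
    its complement is already a neighbourhood of each of its points other than [x]. *)
Record thinning (T : topologicalType) := Thinning {
  removed :> T -> set T;
  removedN : forall x, ~ removed x x;
  closed_removedU1 : forall x, closed (removed x `|` [set x])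
}.

(* [thinned S] is the coarsest refinement of the topology of [T] in which every
   set [~` S x] is a neighbourhood of [x]. *)
Definition thinned (T : topologicalType) (S : thinning T) : Type := T.

HB.instance Definition _ (T : topologicalType) (S : thinning T) :=
  Choice.on (thinned S).

HB.instance Definition _ (T : topologicalType) (S : thinning T) :=
  hasNbhs.Build (thinned S) (fun x => within (~` S x) (nbhs (x : T))).

Section ThinnedTopology.
Variables (T : topologicalType) (S : thinning T).

Lemma nbhs_removedC (x y : T) : ~ S x y -> y != x -> nbhs y (~` S x).
Proof.
move=> Sxy /eqP yx; have ySx : nbhs y (~` (S x `|` [set x])).
  apply: open_nbhs_nbhs; split; first exact/closed_openC/closed_removedU1.
  by case.
by apply: filterS ySx => z zSx Sxz; apply: zSx; left.
Qed.

Let thinned_nbhs_filter (x : thinned S) : ProperFilter (nbhs x).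
Proof.
apply: Build_ProperFilter_ex => A xA.
by exists x; apply: (nbhs_singleton xA); exact: removedN.
Qed.

Let thinned_nbhs_singleton (x : thinned S) (A : set (thinned S)) :
  nbhs x A -> A x.
Proof. by move=> /nbhs_singleton; apply; exact: removedN. Qed.

(** At a point [y] near [x], outside [S x] and distinct from [x], the complement of [S x] is an old
    neighbourhood, so [A] is one too. *)
Let thinned_nbhs_nbhs (x : thinned S) (A : set (thinned S)) :
  nbhs x A -> nbhs x (nbhs^~ A).
Proof.
move=> xA; apply: filterS (nbhs_interior xA) => y /= Ay Sxy.
have [->//|yx] := eqVneq y x.
apply: filterS (filterI Ay (nbhs_removedC Sxy yx)) => z [Az Sxz] _; exact: Az.
Qed.

HB.instance Definition _ := Nbhs_isNbhsTopological.Build (thinned S)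
  thinned_nbhs_filter thinned_nbhs_singleton thinned_nbhs_nbhs.

Lemma nbhs_thinned (x : T) (A : set T) :
  nbhs (x : T) A -> nbhs (x : thinned S) A.
Proof. by apply: filterS => y. Qed.

Lemma open_thinned (U : set T) : open U -> open (U : set (thinned S)).
Proof. by rewrite !openE => oU x /oU /nbhs_thinned. Qed.

Lemma closed_thinned (U : set T) : closed U -> closed (U : set (thinned S)).
Proof. by move=> cU; rewrite -openC; apply: open_thinned; rewrite openC. Qed.

Lemma open_removedC (x : T) : open (~` S x : set (thinned S)).
Proof.
rewrite openE => y Sxy; have [->|yx] := eqVneq y x.
  exact: (@filterE _ (nbhs (x : T))).
exact/nbhs_thinned/nbhs_removedC.
Qed.

Lemma accessible_thinned : accessible_space T -> accessible_space (thinned S).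
Proof.
by move=> T1 x y /T1[U [oU]]; exists U; split => //; exact: open_thinned.
Qed.

Lemma subspace_opens_thinned (Y : set T) :
  (forall y, Y y -> S y `&` Y = set0) ->
  @subspace_opens (thinned S) Y = @subspace_opens T Y.
Proof.
move=> SY; apply/seteqP; split=> _ [U oU <-]; last first.
  by exists U => //; exact: open_thinned.
(* This is the largest open set of [T] whose trace on [Y] lies in [U]. It covers [U] on [Y] because
   [S x] misses [Y] when [x] is in [Y], so removing [S x] leaves traces on [Y] unchanged. *)
exists (\bigcup_(W in [set W | @open T W /\ W `&` Y `<=` U]) W).
  by apply: bigcup_open => W [].
apply/seteqP; split=> x [+ Yx].
  by move=> [W [oW WU] Wx]; split => //; apply: WU.
move=> Ux; split=> //; move: oU; rewrite openE => /(_ _ Ux).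
rewrite /interior /nbhs /= /within /= /prop_near1.
rewrite nbhsE => -[W [oW Wx] WU]; exists W => //; split => // z [Wz Yz].
by apply: WU => // Sxz; have : (S x `&` Y) z by []; rewrite SY.
Qed.

End ThinnedTopology.

(** * Clopen base, irreducibility and weight of a thinned space *)

Section IrreducibleThinning.
Variables (T : topologicalType) (S : thinning T) (D : nat -> set T).
Hypothesis clopenD : forall n, clopen (D n).
Hypothesis baseD : forall x V, nbhs x V -> exists2 n, D n x & D n `<=` V.
Hypothesis open_removed : forall x, open (S x).
(** No basic set built at [y] and containing [x] fits into the complement of [S x]; both
    irreducibility and the large weight rest on this. *)
Hypothesis removed_sep : forall x y n, x <> y -> ~ S y x -> D n x -> D n y ->
  exists z, [/\ D n z, S x z & ~ S y z].

Definition thinned_base (x : thinned S) : set (set (thinned S)) :=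
  [set D n `\` S x | n in [set n | D n x]].

(** Closedness comes from the openness of [S x] in [T]. *)
Lemma open_thinned_base (x : thinned S) : thinned_base x `<=` clopen.
Proof.
move=> _ [n _ <-]; have [oD cD] := clopenD n; split.
  by apply: openI; [exact: open_thinned | exact: open_removedC].
apply: closedI; first exact: closed_thinned.
by rewrite -openC setCK; exact: open_thinned.
Qed.

Lemma nbhs_base_thinned (x : thinned S) : nbhs_base x (thinned_base x).
Proof.
split=> [U xU|V /baseD[n Dnx DV]].
  apply: open_nbhs_nbhs; split; first by have [] := open_thinned_base xU.
  by case: xU => n Dnx <-; split => //; exact: removedN.
by exists (D n `\` S x); [exists n | move=> y [/DV]].
Qed.

Lemma basis_thinned : basis (\bigcup_x thinned_base x).
Proof.
split=> [U [x _ /open_thinned_base[]]//|x V /(nbhs_base_thinned x).2[U xU UV]].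
exists U => //; split; first by exists x.
exact: nbhs_singleton ((nbhs_base_thinned x).1 _ xU).
Qed.

Lemma has_clopen_base_thinned : has_clopen_base (thinned S).
Proof.
exists (\bigcup_x thinned_base x); first exact: basis_thinned.
by move=> U [x _ /open_thinned_base].
Qed.

Lemma first_countable_thinned : first_countable (thinned S).
Proof.
move=> x; exists (thinned_base x); last exact: nbhs_base_thinned.
by apply: (card_le_trans (card_image_le _ _)); exact: countableP.
Qed.

Lemma thinned_base_not_sub (x y : thinned S) U :
  x <> y -> thinned_base y U -> U x -> ~ U `<=` ~` S x.
Proof.
move=> xy [n Dny <-] [Dnx Syx] UV.
have [z [Dnz Sxz Syz]] := removed_sep xy Syx Dnx Dny.
by apply: (UV z).
Qed.

Lemma irreducible_base_thinned : irreducible_base (\bigcup_x thinned_base x).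
Proof.
split; first exact: basis_thinned.
exists thinned_base; split => // [|x [_ basisx]].
  exact: nbhs_base_thinned.
have /basisx[U [[y /= yx yU] Ux] UV] : nbhs x (~` S x : set (thinned S)).
  apply: open_nbhs_nbhs; split; [exact: open_removedC | exact: removedN].
by apply: thinned_base_not_sub yU Ux UV => xy; exact: yx.
Qed.

Lemma weight_thinned (B : set (set (thinned S))) :
  [set: nat -> bool] #<= [set: T] -> basis B -> [set: nat -> bool] #<= B.
Proof.
move=> cT [oB basisB].
(* A member [U] of [B] with [x \in U `<=` ~` S x], together with the index of
   some [D n `\` S x `<=` U], determines [x]. *)
have /choice[h hP] : forall x : thinned S, exists Un : set (thinned S) * nat,
    [/\ B Un.1, Un.1 x, Un.1 `<=` ~` S x, D Un.2 x & D Un.2 `\` S x `<=` Un.1].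
  move=> x; have /basisB[U [BU Ux] US] : nbhs x (~` S x : set (thinned S)).
    apply: open_nbhs_nbhs; split; [exact: open_removedC | exact: removedN].
  have /(nbhs_base_thinned x).2[_ [n Dnx <-] DU] : nbhs x U.
    by apply: open_nbhs_nbhs; split => //; exact: oB.
  by exists (U, n).
have [c c_inj] := card_leT_injective cT.
apply: (@cantor_card_le_prod_nat _ B
  (fun b => (h (c b)).1) (fun b => (h (c b)).2)).
  by move=> b; have [] := hP (c b).
move=> a b hab gab; apply: c_inj; apply: contrapT => ab.
have [Ba Ua aS Da DUa] := hP (c a); have [Bb Ub bS Db DUb] := hP (c b).
apply: (@thinned_base_not_sub (c a) (c b) (D (h (c b)).2 `\` S (c b))) => //.
- by exists (h (c b)).2.
- by split; [rewrite -gab | apply: bS; rewrite -hab].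
- by apply: subset_trans DUb _; rewrite -hab.
Qed.

End IrreducibleThinning.

(** * Thinning by sequences of isolated points *)

Section IsolatedPointsDense.
Variables (T : topologicalType) (D : nat -> set T).
Hypothesis T1 : accessible_space T.
Hypothesis clopenD : forall n, clopen (D n).
Hypothesis baseD : forall x V, nbhs x V -> exists2 n, D n x & D n `<=` V.
Hypothesis isolated_dense :
  forall (x : T) V, nbhs x V -> exists2 z, V z & open [set z].

Lemma isolated_sequence (x : T) : ~ open [set x] ->
  exists A : set T, [/\ ~ A x, A `<=` [set z | open [set z]],
    closure A x & closed (A `|` [set x])].
Proof.
move=> nox.
(* The sets [C n] form a decreasing neighbourhood base of [x], so isolated points [z n] chosen in
   them converge to [x]. *)
pose C n := \bigcap_(k in [set k | (k < n)%N /\ D k x]) D k.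
have xC n : nbhs x (C n).
  elim: n => [|n IHn]; first by apply: filterE => y k [].
  have [Dnx|Dnx] := pselect (D n x).
    have xD : nbhs x (D n).
      by apply: open_nbhs_nbhs; split; have [] := clopenD n.
    apply: filterS (filterI IHn xD) => y [Cy Dy] k [].
    by rewrite ltnS leq_eqVlt => /orP[/eqP ->//|kn Dkx]; exact: Cy.
  apply: filterS IHn => y Cy k [].
  by rewrite ltnS leq_eqVlt => /orP[/eqP ->//|kn Dkx]; exact: Cy.
have /choice[z zP] : forall n, exists z, C n z /\ open [set z].
  by move=> n; have [z Cz oz] := isolated_dense (xC n); exists z.
exists (range z); split.
- by move=> [n _ znx]; apply: nox; rewrite -znx; exact: (zP n).2.
- by move=> _ [n _ <-]; exact: (zP n).2.
- move=> V /baseD[k Dkx DV]; exists (z k.+1); split; first by exists k.+1.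
  by apply: DV; exact: (zP k.+1).1.
rewrite -openC openE => y yA.
have xy : nbhs x (~` [set y]).
  apply: open_nbhs_nbhs; split; last by move=> /= xy; apply: yA; right.
  exact/closed_openC/accessible_closed_set1.
(* [D k] contains [x] but not [y], and it contains [z n] for every [n] above [k]; near [y] only the
   finitely many points [z 0], ..., [z k] remain to be avoided. *)
have [k Dkx Dky] := baseD xy.
have [_ cD] := clopenD k.
have clF : closed (z @` `I_k.+1).
  apply: (iffLR accessible_finite_set_closed T1); apply: finite_image.
  exact: finite_II.
have yDk : nbhs y (~` D k).
  by apply: open_nbhs_nbhs; split; [exact: closed_openC | move=> /Dky; apply].
have yF : nbhs y (~` (z @` `I_k.+1)).
  apply: open_nbhs_nbhs; split; first exact: closed_openC.
  by move=> [n _ zn]; apply: yA; left; exists n.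
apply: filterS (filterI yDk yF) => w [Dkw Fw] [[n _ znw]|wx]; last first.
  by apply: Dkw; rewrite wx.
have [kn|nk] := ltnP k n; last by apply: Fw; exists n.
by apply: Dkw; rewrite -znw; apply: (zP n).1.
Qed.

Lemma exists_thinning : exists S : thinning T,
  [/\ forall x, open (S x),
      forall x, ~ open [set x] -> S x `<=` [set z | open [set z]] &
      forall x y n, x <> y -> ~ S y x -> D n x -> D n y ->
        exists z, [/\ D n z, S x z & ~ S y z]].
Proof.
(* At an isolated [x], the choice [S x = ~` [set x]] makes [[set x]] the only
   member of the thinned base at [x]. *)
have /choice[S SP] : forall x, exists A : set T,
    (open [set x] -> A = ~` [set x]) /\
    (~ open [set x] -> [/\ ~ A x, A `<=` [set z | open [set z]],
                        closure A x & closed (A `|` [set x])]).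
  move=> x; have [ox|nox] := pselect (open [set x]).
    by exists (~` [set x]).
  by have [A AP] := isolated_sequence nox; exists A.
have SN x : ~ S x x.
  by have [/(SP x).1 ->|/(SP x).2[]] := pselect (open [set x]); first by apply.
have cS x : closed (S x `|` [set x]).
  have [/(SP x).1 ->|/(SP x).2[]//] := pselect (open [set x]).
  by rewrite setUC setUv; exact: closedT.
exists (Thinning SN cS) => /=; split=> [x|x /(SP x).2[]//|x y n xy Syx Dnx Dny].
  have [/(SP x).1 ->|/(SP x).2[_ Siso _ _]] := pselect (open [set x]).
    exact/closed_openC/accessible_closed_set1.
  rewrite openE => z Sxz; have zz : nbhs z [set z].
    by apply: open_nbhs_nbhs; split => //; exact: Siso.
  by apply: filterS zz => _ ->.
have [/(SP x).1 ->|nox] := pselect (open [set x]).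
  by exists y; split => // /esym.
have noy : ~ open [set y].
  by move=> /(SP y).1 Sy; apply: Syx; rewrite Sy.
have [_ _ clx _] := (SP x).2 nox.
(* [S y] does not accumulate at [x], whereas [S x] does: a point of [S x] close to [x] is the
   required [z]. *)
have xS : nbhs x (~` S y).
  by apply: (@nbhs_removedC _ (Thinning SN cS)) => //; exact/eqP.
have xD : nbhs x (D n) by apply: open_nbhs_nbhs; split; have [] := clopenD n.
have [z [Sxz [Syz Dz]]] := clx _ (filterI xS xD).
by exists z.
Qed.

End IsolatedPointsDense.

(** Every subset of [Z] is already open in [T]. *)
Lemma subspace_opens_isolated (T : topologicalType) (S : thinning T)
    (Z : set T) : (forall z, Z z -> open [set z]) ->
  @subspace_opens (thinned S) Z = @subspace_opens T Z.
Proof.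
move=> Ziso; apply/seteqP; split=> _ [U oU <-]; last first.
  by exists U => //; exact: open_thinned.
exists (U `&` Z); last by rewrite -setIA setIid.
rewrite openE => z [Uz Zz].
have zz : nbhs (z : T) [set z].
  by apply: open_nbhs_nbhs; split => //; exact: Ziso.
by apply: filterS zz => _ ->.
Qed.

Lemma exists_refinement (T : topologicalType) (D : nat -> set T) :
  accessible_space T ->
  (forall n, clopen (D n)) ->
  (forall x V, nbhs x V -> exists2 n, D n x & D n `<=` V) ->
  (forall (x : T) V, nbhs x V -> exists2 z, V z & open [set z]) ->
  [set: nat -> bool] #<= [set: T] ->
  exists tau : topology_on T,
    let Ttau : topologicalType := Topological.Pack tau in
    [/\ has_clopen_base Ttau,
        first_countable Ttau &
        @open T `<=` @open Ttau] /\
    [/\ (exists Y Z : set T,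
          [/\ Y `|` Z = [set: T],
              @subspace_opens Ttau Y = @subspace_opens T Y &
              @subspace_opens Ttau Z = @subspace_opens T Z]),
        (exists U : set (set Ttau), irreducible_base U) &
        [/\ character_is Ttau [set: nat],
            net_weight_is Ttau [set: nat] &
            weight_is Ttau [set: nat -> bool]]].
Proof.
move=> T1 clopenD baseD isolated_dense cT.
have [S [oS Siso Ssep]] := exists_thinning T1 clopenD baseD isolated_dense.
exists (Topological.class (thinned S)) => /=.
pose Z := [set z : T | open [set z]].
have YZ : ~` Z `|` Z = setT by rewrite setUC setUv.
have SY : @subspace_opens (thinned S) (~` Z) = @subspace_opens T (~` Z).
  apply: subspace_opens_thinned => y /Siso SZ; rewrite -subset0 => z [/SZ Zz].
  by apply.
have SZ : @subspace_opens (thinned S) Z = @subspace_opens T Z.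
  exact: subspace_opens_isolated.
pose part (b : bool) := if b then Z else ~` Z.
have SP b : @subspace_opens (thinned S) (part b) = @subspace_opens T (part b).
  by case: b.
(* Both parts keep their old topology, so the traces of the sets [D n] on the two parts together
   form a countable network of the thinned space. *)
pose N (bn : bool * nat) : set (thinned S) := D bn.2 `&` part bn.1.
have cN : countable (range N).
  by apply: (card_le_trans (card_image_le _ _)); exact: countableP.
have nN : network (range N).
  move=> V x oV Vx; have [b bx] : exists b, part b x.
    by have [Zx|Zx] := pselect (Z x); [exists true | exists false].
  have : @subspace_opens (thinned S) (part b) (V `&` part b) by exists V.
  rewrite SP => -[W oW WV].
  have Wx : W x by have : (V `&` part b) x by []; rewrite -WV => -[].
  have [n Dnx DW] := baseD _ _ (open_nbhs_nbhs (conj oW Wx)).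
  exists (N (b, n)); split => // y [/= /DW Wy by_].
  by have : (W `&` part b) y by []; rewrite WV => -[].
have T1S : accessible_space (thinned S) by exact: accessible_thinned.
have uncT : ~ countable [set: T].
  by move=> /(card_le_trans cT); exact: uncountable_cantor.
have infT : infinite_set [set: thinned S].
  by move=> /finite_set_countable.
have fcS : first_countable (thinned S).
  exact: (first_countable_thinned clopenD baseD oS).
split; split.
- exact: (has_clopen_base_thinned clopenD baseD oS).
- exact: fcS.
- exact: open_thinned.
- by exists (~` Z), Z.
- by eexists; exact: (irreducible_base_thinned clopenD baseD oS Ssep).
split.
- have [x nox] := countable_network_nonisolated cN nN uncT.
  exact: (character_countable T1S nox fcS).
- exact: (net_weight_countable T1S infT cN nN).
split=> [|B]; last exact: (weight_thinned clopenD baseD oS Ssep cT).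
(* The whole topology is a base of size continuum: the countable network bounds it from above,
   [weight_thinned] from below. *)
exists (@open (thinned S)).
  split=> // x V; rewrite nbhsE => -[U [oU Ux] UV].
  by exists U.
rewrite card_eq_le (network_card_open cN nN)/=.
apply: (weight_thinned clopenD baseD oS Ssep cT).
split=> // x V; rewrite nbhsE => -[U [oU Ux] UV].
by exists U.
Qed.

(** * Decimals with small digits *)

Section Decimals.
Variable R : realType.
Local Open Scope ring_scope.
Implicit Types d e : nat -> nat.

Definition dec_sum d n : R := \sum_(i < n) (d i)%:R / 10 ^+ i.+1.

Definition dec d : R := limn (dec_sum d).

(* Digits at most 4 leave gaps: two such decimals are close exactly when they
   share a long prefix, so expansions are unique. *)
Definition small_digits d := forall i, (d i <= 4)%N.

Lemma dec_sumS d n : dec_sum d n.+1 = dec_sum d n + (d n)%:R / 10 ^+ n.+1.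
Proof. by rewrite /dec_sum big_ord_recr. Qed.

Lemma expV10S n : (10 ^+ n)^-1 = 10 * (10 ^+ n.+1)^-1 :> R.
Proof. by rewrite exprS invfM mulrA divff ?mul1r. Qed.

Lemma expV10_gt0 n : 0 < (10 ^+ n)^-1 :> R.
Proof. by rewrite invr_gt0 exprn_gt0. Qed.

Lemma dec_sum_nondecreasing d : nondecreasing_seq (dec_sum d).
Proof.
apply/nondecreasing_seqP => n; rewrite dec_sumS lerDl mulr_ge0 ?ler0n//.
Qed.

(** A digit is at most 4 and 4 + 1/2 is less than 5, so these upper bounds decrease with the number
    of digits; a tail is worth at most half a unit of the last place. *)
Lemma dec_sum_le d n m : small_digits d -> (n <= m)%N ->
  dec_sum d m + 2^-1 / 10 ^+ m <= dec_sum d n + 2^-1 / 10 ^+ n.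
Proof.
move=> d4 /subnK <-; elim: (m - n)%N => [//|k IHk].
apply: le_trans IHk; rewrite addSn dec_sumS (expV10S (k + n)).
have : (d (k + n)%N)%:R <= 4 :> R by rewrite ler_nat.
have := expV10_gt0 (k + n).+1; nra.
Qed.

Lemma is_cvg_dec_sum d : small_digits d -> cvgn (dec_sum d).
Proof.
move=> d4; apply: nondecreasing_is_cvgn (dec_sum_nondecreasing d) _.
exists (dec_sum d 0 + 2^-1 / 10 ^+ 0) => _ [n _ <-].
have := dec_sum_le d4 (leq0n n); have := expV10_gt0 n; lra.
Qed.

Lemma dec_sum_le_dec d n : small_digits d -> dec_sum d n <= dec d.
Proof.
by move=> /is_cvg_dec_sum /(nondecreasing_cvgn_le (dec_sum_nondecreasing d)).
Qed.

Lemma dec_le_dec_sum d n :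
  small_digits d -> dec d <= dec_sum d n + 2^-1 / 10 ^+ n.
Proof.
move=> d4; apply: limr_le; first exact: is_cvg_dec_sum.
exists n => // m /= /(dec_sum_le d4); have := expV10_gt0 m; lra.
Qed.

Lemma eq_dec_sum d e n :
  (forall i, (i < n)%N -> d i = e i) -> dec_sum d n = dec_sum e n.
Proof. by move=> de; apply: eq_bigr => i _; rewrite de. Qed.

Lemma dec_close d e n : small_digits d -> small_digits e ->
  (forall i, (i < n)%N -> d i = e i) -> `|dec d - dec e| <= 2^-1 / 10 ^+ n.
Proof.
move=> d4 e4 /eq_dec_sum den; rewrite ler_norml.
have := dec_sum_le_dec n d4; have := dec_sum_le_dec n e4.
have := dec_le_dec_sum n d4; have := dec_le_dec_sum n e4.
by rewrite den; lra.
Qed.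

(** At the first differing digit the larger decimal gains at least one unit of that place, and the
    tail of the smaller one recovers at most half of it. *)
Lemma dec_far d e n : small_digits d -> small_digits e ->
  (forall i, (i < n)%N -> d i = e i) -> d n <> e n ->
  2^-1 / 10 ^+ n.+1 <= `|dec d - dec e|.
Proof.
wlog lt_den : d e / (d n < e n)%N.
  move=> wlt d4 e4 de /eqP; rewrite neq_ltn => /orP[] lt_n.
    by apply: wlt => // /eqP; rewrite ltn_eqF.
  by rewrite distrC; apply: wlt => // [i /de|/eqP] //; rewrite ltn_eqF.
move=> d4 e4 /eq_dec_sum den _; rewrite ler_normr.
have := dec_sum_le_dec n.+1 e4; have := dec_le_dec_sum n.+1 d4.
rewrite !dec_sumS den.
have : (d n)%:R + 1 <= (e n)%:R :> R by rewrite natr1 ler_nat.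
have := expV10_gt0 n.+1 => ? ? ? ?; apply/orP; right; nra.
Qed.

Lemma dec_agree d e n : small_digits d -> small_digits e ->
  `|dec d - dec e| < 2^-1 / 10 ^+ n -> forall i, (i < n)%N -> d i = e i.
Proof.
move=> d4 e4 de; elim/ltn_ind => i IHi lin; apply: contrapT => di.
(* A first disagreement at [i < n] would separate the decimals by at least the assumed bound. *)
have := dec_far d4 e4 (fun j ji => IHi j ji (ltn_trans ji lin)) di.
apply/negP; rewrite -ltNge; apply: lt_le_trans de _.
rewrite ler_pM2l ?invr_gt0// lef_pV2 ?posrE ?exprn_gt0//.
by rewrite ler_eXn2l// ltr1n.
Qed.

Lemma dec_injective d e :
  small_digits d -> small_digits e -> dec d = dec e -> d = e.
Proof.
move=> d4 e4 de; apply/funext => i; apply: (@dec_agree _ _ i.+1) => //.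
by rewrite de subrr normr0 mulr_gt0// ?invr_gt0// expV10_gt0.
Qed.

Lemma dec_tail d e n : small_digits d -> small_digits e ->
  (forall i, (n <= i)%N -> d i = e i) ->
  dec d - dec e = dec_sum d n - dec_sum e n.
Proof.
move=> d4 e4 de; have cd := is_cvg_dec_sum d4; have ce := is_cvg_dec_sum e4.
rewrite /dec -limB//; apply: cvg_lim => //; apply: cvg_near_cst.
exists n => // m /= /subnK <-.
change (dec_sum d (m - n + n)%N - dec_sum e (m - n + n)%N =
  dec_sum d n - dec_sum e n).
elim: (m - n)%N => [//|k <-].
by rewrite addSn !dec_sumS de ?leq_addl//; lra.
Qed.

Lemma rational_dec_sum d n : rational (dec_sum d n).
Proof.
exists (\sum_(i < n) (d i)%:R / 10 ^+ i.+1) => //.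
rewrite rmorph_sum; apply: eq_bigr => i _.
by rewrite fmorph_div rmorphXn/= !ratr_nat.
Qed.

(** Changing finitely many digits changes the value by a rational number. *)
Lemma irrational_dec_tail d e n : small_digits d -> small_digits e ->
  (forall i, (n <= i)%N -> d i = e i) ->
  irrational (dec d) -> irrational (dec e).
Proof.
move=> d4 e4 de + [r _ er]; apply; have := dec_tail d4 e4 de.
have [p _ <-] := rational_dec_sum d n; have [q _ <-] := rational_dec_sum e n.
move=> /eqP; rewrite subr_eq -er => /eqP ->; exists (p - q + r) => //.
by rewrite !rmorphD rmorphN.
Qed.

End Decimals.

(** * A continuum of irrationals with dense isolated points *)

Section IrrationalSubspace.
Variables (R : realType) (T : topologicalType) (f : T -> R).
Local Open Scope ring_scope.
Hypothesis f_inj : injective f.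
Hypothesis openT : forall U : set T,
  open U <-> exists2 O : set R, open O & f @^-1` O = U.
Hypothesis f_irrational : forall x, irrational (f x).

Lemma nbhs_preimageP (x : T) (V : set T) :
  nbhs x V <->
  exists2 e, 0 < e & forall y, `|f x - f y| < e -> V y.
Proof.
split=> [|[e e0 eV]].
  rewrite nbhsE => -[U [/openT[W oW <-] /= Wx] UV].
  have /nbhs_ballP[e e0 eW] := open_nbhs_nbhs (conj oW Wx).
  by exists e => // y xy; apply: UV; exact: eW.
rewrite nbhsE; exists (f @^-1` ball (f x) e); last by move=> y /eV.
split; last exact: ballxx.
by apply/openT; exists (ball (f x) e) => //; exact: ball_open.
Qed.

Lemma accessible_preimage : accessible_space T.
Proof.
move=> x y xy; exists (f @^-1` ~` [set f y]); split.
- apply/openT; exists (~` [set f y]) => //; apply: closed_openC.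
  exact/accessible_closed_set1/hausdorff_accessible/Rhausdorff.
- by apply/mem_set => /= /f_inj /eqP; apply/negP.
- by apply/mem_set => /=; apply.
Qed.

(** Indices that code no pair of rationals get the whole space, which is clopen as well. *)
Definition rational_interval n : set T :=
  if @choice.unpickle (rat * rat)%type n is Some (p, q)
  then f @^-1` `]ratr p, ratr q[ else setT.

Lemma clopen_rational_interval n : clopen (rational_interval n).
Proof.
rewrite /rational_interval; case: unpickle => [[p q]|]; last exact: clopenT.
split.
  by apply/openT; exists `]ratr p, ratr q[%classic => //; exact: interval_open.
(* The endpoints are rational, hence not values of [f]. *)
have -> : f @^-1` `]ratr p, ratr q[ = f @^-1` `[ratr p, ratr q].
  apply/seteqP; split=> x /=; rewrite !in_itv/=.
    by move=> /andP[/ltW -> /ltW ->].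
  rewrite !le_eqVlt => /andP[/orP[/eqP px|->] /orP[/eqP qx|->]] //; exfalso.
  - by case: (@f_irrational x); exists p.
  - by case: (@f_irrational x); exists p.
  - by case: (@f_irrational x); exists q.
rewrite -openC; apply/openT; exists (~` `[ratr p, ratr q]) => //.
exact/closed_openC/interval_closed.
Qed.

Lemma rational_interval_base (x : T) V :
  nbhs x V -> exists2 n, rational_interval n x & rational_interval n `<=` V.
Proof.
move=> /nbhs_preimageP[e e0 eV].
have [p] : exists p, ratr p \in `]f x - e, f x[ by apply: rat_in_itvoo; lra.
have [q] : exists q, ratr q \in `]f x, f x + e[ by apply: rat_in_itvoo; lra.
rewrite !in_itv/= => /andP[xq qx] /andP[px xp].
exists (choice.pickle (p, q)); rewrite /rational_interval pickleK /=.
  by rewrite in_itv/= xp xq.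
move=> y /=; rewrite in_itv/= => /andP[py yq]; apply: eV.
by rewrite ltr_norml; lra.
Qed.

End IrrationalSubspace.

Section IrrationalDecimals.
Variable R : realType.
Local Open Scope ring_scope.

(** The free low bits [c] yield uncountably many distinct decimals, too many for all of them to be
    rational. *)
Lemma exists_irrational_dec (b : nat -> bool) :
  exists c : nat -> bool, irrational (dec R (fun i => (b i).*2 + c i)%N).
Proof.
apply: contrapT => /forallNP rat_dec; apply: uncountable_cantor.
have /choice[q qP] : forall c : nat -> bool, exists q : rat,
    ratr q = dec R (fun i => (b i).*2 + c i)%N.
  by move=> c; have [q _ qc] := contrapT (rat_dec c); exists q.
have q_inj : injective q.
  move=> c c' /(congr1 (@ratr R)); rewrite !qP => /dec_injective cc'.
  have small (a : nat -> bool) : small_digits (fun i => (b i).*2 + a i)%N.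
    by move=> i; case: (b i) (a i) => [] [].
  apply/funext => i; have := congr1 (fun d => d i) (cc' (small _) (small _)).
  by move=> /addnI; case: (c i) (c' i) => [] [].
apply: (@card_le_trans _ _ _ [set: rat]); last exact: countableP.
exact: injective_card_le q_inj _.
Qed.

(** The high bit of each digit records [b]; the low bit is spent on irrationality. *)
Definition irrational_digits (b : nat -> bool) : nat -> nat :=
  let c := projT1 (cid (exists_irrational_dec b)) in
  fun i => ((b i).*2 + c i)%N.

Lemma irrational_digits_lt4 b i : (irrational_digits b i < 4)%N.
Proof. by rewrite /irrational_digits; case: (b i) (projT1 _ i) => [] []. Qed.

Lemma irrational_digitsP b : irrational (dec R (irrational_digits b)).
Proof. by rewrite /irrational_digits; case: cid. Qed.

Lemma irrational_digits_inj : injective irrational_digits.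
Proof.
have high b i : (1 < irrational_digits b i)%N = b i.
  rewrite /irrational_digits; case: (b i); by case: (projT1 _ i).
move=> a b ab; apply/funext => i; by rewrite -(high a) ab high.
Qed.

(* The tail is irrational and does not depend on [b], so that agreeing with
   [marked_digits b n] up to the digit 4 forces equality. *)
Definition marked_digits b n : nat -> nat := fun i =>
  if (i < n)%N then irrational_digits b i
  else if i == n then 4 else irrational_digits xpred0 i.

Definition digit_code (d : nat -> nat) :=
  (exists b, d = irrational_digits b) \/ (exists b n, d = marked_digits b n).

Lemma digit_code_small d : digit_code d -> small_digits d.
Proof.
move=> [[b ->]|[b [n ->]]] i; first exact/ltnW/irrational_digits_lt4.
rewrite /marked_digits; do 2?case: ifP => // _.
  exact/ltnW/irrational_digits_lt4.
exact/ltnW/irrational_digits_lt4.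
Qed.

Lemma digit_code_irrational d : digit_code d -> irrational (dec R d).
Proof.
move=> dC; case: (dC) => [[b ->]|[b [n dE]]]; first exact: irrational_digitsP.
(* The fixed tail starts right after the digit 4 in place [n], hence at [n.+1]. *)
apply: (@irrational_dec_tail _ (irrational_digits xpred0) d n.+1).
- by apply: digit_code_small; left; exists xpred0.
- exact: digit_code_small.
- by move=> i ni; rewrite dE /marked_digits ltnNge (ltnW ni) gtn_eqF.
- exact: irrational_digitsP.
Qed.

(** All digits before and after a mark are at most 3, so a 4 in place [n] can only be the mark of
    [d]; past it both sequences follow the common tail. *)
Lemma marked_digits_isolated b n d : digit_code d ->
  (forall i, (i < n.+1)%N -> d i = marked_digits b n i) ->
  d = marked_digits b n.
Proof.
move=> dC db; have := db n (leqnn _).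
rewrite {1}/marked_digits ltnn eqxx; case: dC => [[a ->] a4|[a [m dE]] d4].
  by have := irrational_digits_lt4 a n; rewrite a4.
have mn : m = n.
  move: d4; rewrite dE /marked_digits; case: ltngtP => // _ a4.
    by have := irrational_digits_lt4 a n; rewrite a4.
  by have := irrational_digits_lt4 xpred0 n; rewrite a4.
apply/funext => i; have [/db //|ni] := ltnP i n.+1.
by rewrite dE mn /marked_digits ltnNge (ltnW ni) gtn_eqF.
Qed.

Definition decimal_set : set (irrational_space R) :=
  [set x | exists2 d, digit_code d & dec R d = \val x].

Definition real_of (x : decimal_set) : R := \val (\val x).

Lemma real_of_inj : injective real_of.
Proof. by move=> x y /val_inj /val_inj. Qed.

Lemma open_decimal_set (U : set decimal_set) :
  open U <-> exists2 O : set R, open O & real_of @^-1` O = U.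
Proof.
split=> [[_ [W oW <-] <-]|[W oW <-]]; first by exists W.
by exists (\val @^-1` W) => //; exists W.
Qed.

Lemma exists_real_of d : digit_code d -> exists x, real_of x = dec R d.
Proof.
move=> dC.
pose x : irrational_space R := SigSub (mem_set (digit_code_irrational dC)).
have Xx : decimal_set x by exists d.
by exists (SigSub (mem_set Xx)).
Qed.

Lemma real_ofP x : exists2 d, digit_code d & real_of x = dec R d.
Proof. by have [d dC dx] := set_mem (valP x); exists d. Qed.

Lemma isolated_decimal_dense (x : decimal_set) V :
  nbhs x V -> exists2 z, V z & open [set z].
Proof.
have nbhsP := nbhs_preimageP open_decimal_set.
have iso z b n : real_of z = dec R (marked_digits b n) -> open [set z].
  move=> zE; rewrite openE => _ ->; apply/nbhsP.
  (* Within this distance the digits agree up to and including the 4 in place [n]. *)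
  exists (2^-1 / 10 ^+ n.+1).
    by rewrite mulr_gt0// ?invr_gt0// expV10_gt0.
  move=> y yz; apply: real_of_inj; rewrite zE; have [d dC yE] := real_ofP y.
  rewrite yE; congr dec; apply: marked_digits_isolated => //.
  apply: (@dec_agree R); first exact: digit_code_small.
    by apply: digit_code_small; right; exists b, n.
  by rewrite distrC -zE -yE.
move=> xV; have [d dC xE] := real_ofP x.
case: (dC) => [[b dE]|[b [n dE]]]; last first.
  by exists x; [exact: nbhs_singleton | apply: iso; rewrite xE dE].
have /nbhsP[e e0 eV] := xV.
(* [marked_digits b n] shares its first [n] digits with [irrational_digits b], so for large [n] it
   gives an isolated point within [e] of [x]. *)
have [n ne] : exists n, (10 ^+ n)^-1 < e.
  exists (Num.bound e^-1); rewrite invf_plt ?posrE ?exprn_gt0//.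
  apply: lt_le_trans (archi_boundP _) _; first by rewrite invr_ge0 ltW.
  by rewrite -natrX ler_nat ltnW// ltn_expl.
have [z zE] := exists_real_of (or_intror (ex_intro _ b (ex_intro _ n erefl))).
exists z; last exact: iso zE.
apply: eV; apply: le_lt_trans ne; rewrite xE zE.
have xz : `|dec R d - dec R (marked_digits b n)| <= 2^-1 / 10 ^+ n.
  apply: dec_close; [exact: digit_code_small| |].
    by apply: digit_code_small; right; exists b, n.
  by move=> i ni; rewrite dE /marked_digits ni.
by apply: le_trans xz _; have := expV10_gt0 R n; lra.
Qed.

Lemma cantor_card_le_decimal_set : [set: nat -> bool] #<= [set: decimal_set].
Proof.
have /choice[x xP] b : exists x, real_of x = dec R (irrational_digits b).
  by apply: exists_real_of; left; exists b.
apply: (@injective_card_le _ _ x) => // a b /(congr1 real_of); rewrite !xP.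
by move=> /dec_injective ab; apply/irrational_digits_inj/ab;
  apply: digit_code_small; left; [exists a | exists b].
Qed.

End IrrationalDecimals.

Theorem theorem3p1 (R : realType) :
  exists (X : set (irrational_space R)) (tau : topology_on X),
    let Xtau : topologicalType := Topological.Pack tau in
    [/\ X #= [set: nat -> bool],
        has_clopen_base Xtau,
        first_countable Xtau &
        @open X `<=` @open Xtau] /\
    [/\ (exists Y Z : set X,
          [/\ Y `|` Z = [set: X],
              @subspace_opens Xtau Y = @subspace_opens X Y &
              @subspace_opens Xtau Z = @subspace_opens X Z]),
        (exists U : set (set Xtau), irreducible_base U) &
        [/\ character_is Xtau [set: nat],
            net_weight_is Xtau [set: nat] &
            weight_is Xtau [set: nat -> bool]]].
Proof.
have openX := @open_decimal_set R; have inj := @real_of_inj R.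
have irr (x : @decimal_set R) : irrational (real_of x).
  exact: set_mem (valP (\val x)).
have T1 := accessible_preimage inj openX.
have clopenX := clopen_rational_interval openX irr.
have baseX := rational_interval_base openX.
have cX := cantor_card_le_decimal_set R.
have [tau [[zd fc ref] rest]] :=
  exists_refinement T1 clopenX baseX (@isolated_decimal_dense R) cX.
exists (@decimal_set R), tau; split => //; split => //.
rewrite -(card_eql (card_setT _)) card_eq_le cX andbT.
(* The rational intervals form a countable network, which bounds the size of a T1 space by the
   continuum. *)
apply: (@network_card_points _ (range (rational_interval (@real_of R))) T1).
  by apply: (card_le_trans (card_image_le _ _)); exact: countableP.
move=> V x oV Vx; have [n nx nV] := baseX _ _ (open_nbhs_nbhs (conj oV Vx)).
by eexists; split; [exists n | exact: nx | exact: nV].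
Qed.
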